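(* Let $t\geq 1$ be an integer. If $G$ is a connected $U(H_t)$-minor-free graph, then $c(G)\leq t+2$.
   Context: All graphs are finite and simple. $H_t$ is the graph formed from $t$ copies of a five-vertex path by identifying all their first vertices into one vertex $a$ and all their last vertices into one vertex $b$ (so $H_t$ consists of $t$ internally vertex-disjoint $a$–$b$ paths with 4 edges each). For a graph $F$, $U(F)$ denotes the graph obtained from $F$ by adding a new vertex adjacent to all vertices of $F$. A graph $G$ is $H$-minor-free if no graph isomorphic to $H$ can be obtained from $G$ by deleting vertices, deleting edges and contracting edges. Cop number: in the game of cops and robbers on $G$, one player places $m$ cops on (not necessarily distinct) vertices, then the other player places the robber on a vertex. Then, starting with the cops, the players alternate turns; on a turn, a player may move any of their pieces to an adjacent vertex (each piece moves at most once, and any piece may stay put). The cops win if at some point some cop occupies the same vertex as the robber; the robber wins by evading capture forever. The cop number $c(G)$ is the minimum $m$ such that the cops have a winning strategy. *)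

(* Defs.v *)
From mathcomp Require Import boolp.
From mathcomp Require Import all_boot.
Set Implicit Arguments.
Unset Strict Implicit.
Unset Printing Implicit Defensive.

Record sgraph := SGraph {
  vertex :> finType;
  edge : rel vertex;
  edge_sym : symmetric edge;
  edge_irr : irreflexive edge }.

Arguments edge {_}.

(* As usual, the graph without vertices does not count as connected. *)
Definition connected (G : sgraph) : Prop :=
  0 < #|G| /\ forall x y : G, connect edge x y.

Definition isomorphic (G H : sgraph) : Prop :=
  exists2 f : G -> H, bijective f & forall x y, edge (f x) (f y) = edge x y.

Section MinorOperations.
Variable G : sgraph.

Definition del_vertex_rel (v : G) : rel {x : G | x != v} :=
  fun x y => edge (val x) (val y).

Fact del_vertex_sym v : symmetric (@del_vertex_rel v).
Proof. by move=> x y; rewrite /del_vertex_rel edge_sym. Qed.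

Fact del_vertex_irr v : irreflexive (@del_vertex_rel v).
Proof. by move=> x; rewrite /del_vertex_rel edge_irr. Qed.

Definition del_vertex (v : G) : sgraph :=
  SGraph (@del_vertex_sym v) (@del_vertex_irr v).

Definition del_edge_rel (u v : G) : rel G :=
  fun x y => edge x y && ([set x; y] != [set u; v]).

Fact del_edge_sym u v : symmetric (del_edge_rel u v).
Proof. by move=> x y; rewrite /del_edge_rel edge_sym setUC. Qed.

Fact del_edge_irr u v : irreflexive (del_edge_rel u v).
Proof. by move=> x; rewrite /del_edge_rel edge_irr. Qed.

Definition del_edge (u v : G) : sgraph :=
  SGraph (@del_edge_sym u v) (@del_edge_irr u v).

(* In the contraction of [uv], the vertex [u] stands for the merged vertex and
   [v] disappears; the loop and the parallel edges that arise are dropped. *)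
Definition contract_rel (u v : G) : rel {x : G | x != v} :=
  fun x y => (x != y) &&
    [|| edge (val x) (val y),
        (val x == u) && edge v (val y) |
        (val y == u) && edge (val x) v].

Fact contract_sym u v : symmetric (@contract_rel u v).
Proof.
move=> x y; rewrite /contract_rel eq_sym; congr (_ && _).
rewrite [edge (val y) (val x)]edge_sym [edge v (val x)]edge_sym.
by rewrite [edge (val y) v]edge_sym; congr (_ || _); rewrite orbC.
Qed.

Fact contract_irr u v : irreflexive (@contract_rel u v).
Proof. by move=> x; rewrite /contract_rel eqxx. Qed.

Definition contract (u v : G) : sgraph :=
  SGraph (@contract_sym u v) (@contract_irr u v).

End MinorOperations.

(* [has_minor G H]: a graph isomorphic to [H] can be obtained from [G] by a
   sequence of vertex deletions, edge deletions and edge contractions. *)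
Inductive has_minor : sgraph -> sgraph -> Prop :=
| minor_iso (G H : sgraph) : isomorphic G H -> has_minor G H
| minor_del_vertex (G H : sgraph) (v : G) : has_minor (del_vertex v) H -> has_minor G H
| minor_del_edge (G H : sgraph) (u v : G) :
    edge u v -> has_minor (del_edge u v) H -> has_minor G H
| minor_contract (G H : sgraph) (u v : G) :
    edge u v -> has_minor (contract u v) H -> has_minor G H.

Definition minor_free (H G : sgraph) : Prop := ~ has_minor G H.

Section Universal.
Variable F : sgraph.

Definition universal_rel : rel (option F) := fun x y =>
  match x, y with
  | Some x', Some y' => edge x' y'
  | None, None => false
  | _, _ => true
  end.

Fact universal_sym : symmetric universal_rel.
Proof. by case=> [x|] [y|] //=; rewrite edge_sym. Qed.

Fact universal_irr : irreflexive universal_rel.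
Proof. by case=> [x|] //=; rewrite edge_irr. Qed.

(* The graph U(F). *)
Definition add_universal : sgraph := SGraph universal_sym universal_irr.

End Universal.

Section Theta.
Variable t : nat.

(* [inl false] is a, [inl true] is b, and [inr (i, k)] is the k-th internal
   vertex of the i-th path. *)
Definition theta_vertex : finType := (bool + 'I_t * 'I_3)%type.

(* The k-th vertex of the i-th copy of the path 0 - 1 - 2 - 3 - 4, after all
   the vertices 0 have been identified, and all the vertices 4 as well. *)
Definition theta_path (i : 'I_t) (k : 'I_5) : theta_vertex :=
  if k == 0 :> nat then inl false
  else if k == 4 :> nat then inl true
  else inr (i, inord k.-1).

Definition theta_rel : rel theta_vertex := fun x y =>
  [exists i : 'I_t, exists k : 'I_5, exists l : 'I_5,
    [&& (k.+1 == l) || (l.+1 == k), x == theta_path i k & y == theta_path i l]].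

Fact theta_sym : symmetric theta_rel.
Proof.
have sub x y : theta_rel x y -> theta_rel y x.
  case/existsP=> i /existsP[k /existsP[l /and3P[kl xk yl]]].
  apply/existsP; exists i; apply/existsP; exists l; apply/existsP; exists k.
  by rewrite orbC kl xk yl.
by move=> x y; apply/idP/idP; apply: sub.
Qed.

Fact theta_irr : irreflexive theta_rel.
Proof.
move=> x; apply/negbTE/negP.
case/existsP=> i /existsP[k /existsP[l /and3P[kl /eqP-> /eqP]]].
rewrite /theta_path; move: kl.
case: k l => [[|[|[|[|[|k]]]]] Hk] [[|[|[|[|[|l]]]]] Hl] //= _;
  by case=> /(congr1 val); rewrite /= !inordK.
Qed.

(* The graph H_t. *)
Definition theta_graph : sgraph := SGraph theta_sym theta_irr.

End Theta.

Section CopsAndRobbers.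
Variable G : sgraph.

Definition step (x y : G) : bool := (x == y) || edge x y.

(* A strategy for [m] cops: [s [::]] is the initial placement of the cops, and
   [s [:: r_0; ...; r_n]] their placement after their (n+1)-st turn, when the
   robber started at [r_0] and moved to [r_1], ..., [r_n]. *)
Definition legal_strategy m (s : seq G -> 'I_m -> G) : Prop :=
  forall (h : seq G) (r : G) (i : 'I_m), step (s h i) (s (rcons h r) i).

Definition legal_robber (r : nat -> G) : Prop :=
  forall n, step (r n) (r n.+1).

(* When the robber arrives at [r n], the cops stand at [s (mkseq r n)]; they
   then move to [s (mkseq r n.+1)] while the robber is still at [r n]. *)
Definition captured m (s : seq G -> 'I_m -> G) (r : nat -> G) : Prop :=
  exists n (i : 'I_m), s (mkseq r n) i = r n \/ s (mkseq r n.+1) i = r n.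

Definition cops_win (m : nat) : Prop :=
  exists2 s : seq G -> 'I_m -> G,
    legal_strategy s & forall r, legal_robber r -> captured s r.

Fact cops_win_card : exists m, `[< cops_win m >].
Proof.
exists #|G|; apply/asboolP; exists (fun _ i => enum_val i).
  by move=> h r i; rewrite /step eqxx.
by move=> r _; exists 0, (enum_rank (r 0)); left; rewrite enum_rankK.
Qed.

Definition cop_number : nat := ex_minn cops_win_card.

End CopsAndRobbers.

(* Main.v *)
Require Import Defs.
From mathcomp Require Import boolp.
From mathcomp Require Import all_boot.

(** The cops confine the robber to a connected territory [C] that shrinks. Each
    cop on duty stands, after every turn, on the image of the robber under a map
    that is 1-Lipschitz on [C], such as the retraction onto a geodesic; this
    protects the exits of [C] on that geodesic. The exits lie in two disjoint
    connected hubs [A] and [B], with at most one exit each, and on at most [t.+1]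
    disjoint paths from [A] to [B], with one cop per path. One of these cops also
    guards the hubs, so one cop is always free. Suppose that both hubs have
    exits. If there are at most [t] paths, the free cop adds a geodesic between
    the hubs through [C]. Otherwise some path other than the one of the cop who
    guards the hubs has at most two exits, as [A], [B], [C] and [t] paths with
    three exits each would be a minor model of U(H_t); the free cop guards a
    geodesic through [C] between these two exits (or, if there are fewer, ending
    at exits of the hubs), which replaces the part of the path between them and
    relieves the cop of that path. A hub without exits
    absorbs a path up to its first exit. *)

Set Implicit Arguments.
Unset Strict Implicit.
Unset Printing Implicit Defensive.

Lemma step_refl (G : sgraph) (x : G) : step x x.
Proof. by rewrite /step eqxx. Qed.

Lemma edge_step (G : sgraph) (x y : G) : edge x y -> step x y.
Proof. by rewrite /step orbC => ->. Qed.

Lemma step_sym (G : sgraph) (x y : G) : step x y = step y x.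
Proof. by rewrite /step eq_sym edge_sym. Qed.

(** * The game as a reachability problem *)

Section Game.
Variables (G : sgraph) (m : nat).
Implicit Types (p : 'I_m -> G) (r : G).

Definition legal p p' := forall i, step (p i) (p' i).

(* With the robber at [r] about to move, the cops at [p] win within [n] rounds. *)
Fixpoint win_within n p r : Prop :=
  (exists i, p i = r) \/
  if n is n'.+1 then
    forall r', step r r' -> exists2 p', legal p p' & win_within n' p' r'
  else False.

Definition wins p r := exists n, win_within n p r.

Lemma win_within_leq n n' p r : n <= n' -> win_within n p r -> win_within n' p r.
Proof.
elim: n n' p r => [|n IH] [|n'] p r //= le_nn' [caught|win]; try by left.
by right=> r' /win[p' pp' win']; exists p' => //; apply: IH win'.
Qed.

Lemma wins_caught p r i : p i = r -> wins p r.
Proof. by move=> pir; exists 0; left; exists i. Qed.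

(** The number of rounds needed may depend on [r']; as [G] is finite, a maximum over all [r'] bounds
    it. *)
Lemma wins_round p r :
  (forall r', step r r' -> exists2 p', legal p p' & wins p' r') -> wins p r.
Proof.
move=> win.
have bound (r' : G) : exists n, step r r' ->
    exists2 p', legal p p' & win_within n p' r'.
  case: (boolP (step r r')) => [/win[p' pp' [n win']]|_]; last by exists 0.
  by exists n => _; exists p'.
have [N winN] := choice bound.
exists (\max_r' N r').+1; right=> r' /winN[p' pp' win']; exists p' => //.
by apply: win_within_leq win'; apply: (leq_bigmax r').
Qed.

(** One reply serves all [n] at once: take one for which the number of rounds is least and use
    monotonicity in [n]. If no reply wins, any legal one will do. *)
Lemma best_response p r :
  exists p', legal p p' /\
    forall n p'', legal p p'' -> win_within n p'' r -> win_within n p' r.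
Proof.
have [win|lose] := pselect (exists n, `[< exists2 p', legal p p' & win_within n p' r >]).
  case: (ex_minnP win) => n /asboolP[p' pp' win'] min_n.
  exists p'; split=> // k p'' pp'' win''.
  by apply: win_within_leq win'; apply: min_n; apply/asboolP; exists p''.
exists p; split=> [i|n p'' pp'' win'']; first exact: step_refl.
by case: lose; exists n; apply/asboolP; exists p''.
Qed.

(** The cops always play a best response, so the history only serves to determine their present
    placement. *)
Lemma cop_number_le p0 : (forall r, wins p0 r) -> cop_number G <= m.
Proof.
move=> win; have [resp respP] := choice (fun pr => best_response pr.1 pr.2).
pose s (h : seq G) := foldl (fun p r => resp (p, r)) p0 h.
have sS (r : nat -> G) n : s (mkseq r n.+1) = resp (s (mkseq r n), r n).
  by rewrite mkseqS /s foldl_rcons.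
rewrite /cop_number; case: ex_minnP => k _; apply; apply/asboolP; exists s.
  by move=> h r i; rewrite /s foldl_rcons; have [legal_resp _] := respP (s h, r); apply: legal_resp.
move=> r legal_r.
(* [n] counts the rounds left once the cops have answered the move to [r k']. On the first turn,
   staying at [p0] is a legal answer that wins, so the best response wins too. *)
suff main (n k' : nat) : win_within n (s (mkseq r k'.+1)) (r k') -> captured s r.
  have [n win0] := win (r 0); apply: (main n 0).
  rewrite sS; have [_] := respP (s (mkseq r 0), r 0); apply; last exact: win0.
  by move=> i; apply: step_refl.
elim: n k' => [|n IH] k' [[i caught]|//]; try by exists k', i; right.
move=> /(_ _ (legal_r k'))[p' pp' win']; apply: (IH k'.+1).
by rewrite sS; have [_] := respP (s (mkseq r k'.+1), r k'.+1); apply; last exact: win'.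
Qed.

End Game.

(** * Connected sets *)

Section ConnectedSets.
Variable G : sgraph.
Implicit Types (X Y : {set G}) (x y : G) (s : seq G).

Definition inside X : rel G := [rel x y | [&& x \in X, y \in X & edge x y]].

(** The empty set is connected in this sense, which permits empty hubs. *)
Definition conn X := {in X &, forall x y, connect (inside X) x y}.

Lemma inside_sym X : connect_sym (inside X).
Proof.
apply: sym_connect_sym => x y.
by rewrite /inside /= edge_sym andbCA.
Qed.

Lemma conn_subsingleton X : {in X &, forall x y, x = y} -> conn X.
Proof. by move=> X1 x y Xx Xy; rewrite (X1 x y). Qed.

Lemma conn1 x : conn [set x].
Proof. by apply: conn_subsingleton => y z /set1P-> /set1P->. Qed.

Lemma conn_add X x y : conn X -> x \in X -> edge x y -> conn (y |: X).
Proof.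
move=> cX Xx xy.
have sub : subrel (connect (inside X)) (connect (inside (y |: X))).
  apply: connect_sub => u v /and3P[Xu Xv uv]; apply: connect1.
  by rewrite /inside /= !inE Xu Xv uv !orbT.
have toy u : u \in y |: X -> connect (inside (y |: X)) u y.
  case/setU1P=> [->|Xu]; first exact: connect0.
  apply: connect_trans (sub _ _ (cX u x Xu Xx)) _; apply: connect1.
  by rewrite /inside /= !inE Xx xy eqxx orbT.
move=> u v /toy uy /toy vy; apply: connect_trans uy _.
by rewrite inside_sym.
Qed.

Lemma conn_path X x s : conn X -> x \in X -> path edge x s ->
  conn (X :|: [set y in s]).
Proof.
elim: s x X => [|y s IH] x X cX Xx /=.
  by move=> _; suff -> : X :|: [set y in [::]] = X by []; apply/setP => z; rewrite !inE orbF.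
case/andP=> xy ys.
suff -> : X :|: [set z in y :: s] = (y |: X) :|: [set z in s].
  by apply: (IH y) => //; [apply: conn_add Xx xy|rewrite !inE eqxx].
by apply/setP => z; rewrite !inE orbCA orbA.
Qed.

Lemma conn_seq x s : path edge x s -> conn [set y in x :: s].
Proof.
move=> xs; suff -> : [set y in x :: s] = [set x] :|: [set y in s].
  by apply: conn_path xs; [apply: conn1|rewrite inE].
by apply/setP => z; rewrite !inE.
Qed.

Definition component X x : {set G} := [set y | connect (inside X) x y].

Lemma component_sub X x : x \in X -> component X x \subset X.
Proof.
move=> Xx; apply/subsetP => y; rewrite inE => /connectP[s xs ->].
by elim: s x xs Xx => //= z s IH x /andP[/and3P[_ Xz _]] /IH /[swap] _; apply.
Qed.

Lemma component_edge X x y z : y \in component X x -> y \in X -> z \in X ->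
  edge y z -> z \in component X x.
Proof.
rewrite !inE => xy Xy Xz yz; apply: connect_trans xy _.
by apply: connect1; rewrite /inside /= Xy Xz.
Qed.

(** Every prefix of a walk in [X] from [x] ends in the component, so the walk stays inside it. *)
Lemma conn_component X x : conn (component X x).
Proof.
have toy y : y \in component X x -> connect (inside (component X x)) x y.
  rewrite inE => /connectP[s xs ->].
  elim/last_ind: s xs => [|s z IH]; first by rewrite connect0.
  rewrite rcons_path last_rcons => /andP[xs sz].
  apply: connect_trans (IH xs) _; apply: connect1.
  have xl : connect (inside X) x (last x s) by apply/connectP; exists s.
  case/and3P: (sz) => _ _ lz; rewrite /inside /= !inE xl lz andbT /=.
  by apply: connect_trans xl _; apply: connect1.
by move=> u v /toy xu /toy xv; apply: connect_trans xv; rewrite inside_sym.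
Qed.

(** For a territory [X] these are its exits. *)
Definition attached X x := (x \notin X) && [exists u in X, edge u x].

Lemma attachedP X x :
  reflect (x \notin X /\ exists2 u, u \in X & edge u x) (attached X x).
Proof.
apply: (iffP andP) => -[nXx].
  by case/exists_inP=> u Xu ux; split=> //; exists u.
by case=> u Xu ux; split=> //; apply/exists_inP; exists u.
Qed.

End ConnectedSets.

(** * Duties of cops *)

Section Duties.
Variables (G : sgraph) (m : nat).
Hypothesis Gconn : connected G.
Implicit Types (C : {set G}) (D : {set 'I_m}) (x y u v r : G).
Implicit Types (f : 'I_m -> G -> G) (g : G -> G) (p : 'I_m -> G).

(* A cop with duty [g] stands on [g r] after each turn of the cops, where [r]
   is the position of the robber. *)
Definition trackable g C :=
  {in C &, forall u v, edge u v -> step (g u) (g v)}.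

(** A robber who leaves [C] for [x] is caught there by the cop with duty [g]. *)
Definition guards g C x := {in C, forall u, edge u x -> step (g u) x}.

Definition on_duty f D p r := forall i, i \in D -> p i = f i r.

Definition winning f D C :=
  forall p r, r \in C -> on_duty f D p r -> wins p r.

Definition assign f j g : 'I_m -> G -> G := fun i => if i == j then g else f i.

Definition confined f D C :=
  (forall i, i \in D -> trackable (f i) C) /\
  (forall x, attached C x -> exists2 i, i \in D & guards (f i) C x).

Lemma guards_sub g C C' x : C' \subset C -> guards g C x -> guards g C' x.
Proof. by move=> /subsetP sC gx u /sC; apply: gx. Qed.

Lemma trackable_sub g C C' : C' \subset C -> trackable g C -> trackable g C'.
Proof. by move=> /subsetP sC gt u v /sC Cu /sC; apply: gt. Qed.

Lemma winning_subset f D D' C : D' \subset D -> winning f D' C -> winning f D C.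
Proof.
by move=> /subsetP sD win p r Cr dut; apply: win => // i /sD; apply: dut.
Qed.

(* The robber cannot leave [C] without being caught, so a cop who is off duty
   may move freely while the robber stays in [C]. *)
Lemma wins_free_move f D C j p r : confined f D C -> j \notin D ->
  r \in C -> on_duty f D p r ->
  (forall r', r' \in C -> step r r' -> exists2 y, step (p j) y &
    forall p', on_duty f D p' r' -> p' j = y -> wins p' r') ->
  wins p r.
Proof.
move=> [track guard] jD Cr dut win; apply: wins_round => r' rr'.
have [Cr'|nCr'] := boolP (r' \in C).
  have [y pjy win'] := win r' Cr' rr'.
  exists (fun i => if i == j then y else if i \in D then f i r' else p i).
    move=> i; case: eqP => [->//|_]; case: (boolP (i \in D)) => [Di|_]; last exact: step_refl.
    rewrite dut //; case/orP: rr' => [/eqP->|rr']; first exact: step_refl.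
    exact: track.
  apply: win'; last by rewrite eqxx.
  by move=> i Di; rewrite Di; case: eqP => // ij; rewrite -ij Di in jD.
have {}rr' : edge r r' by case/orP: rr' Cr nCr' => [/eqP->->|].
have [|i Di gi] := guard r'; first by apply/attachedP; split=> //; exists r.
exists (fun k => if k == i then r' else p k).
  by move=> k; case: eqP => [->|_]; [rewrite dut //; apply: gi|apply: step_refl].
by apply: (@wins_caught _ _ _ _ i); rewrite eqxx.
Qed.

(* A new duty [q \o d] is taken up by walking to [q 0] and then along [q]: as
   [d r] changes by at most one per round, it cannot be overtaken unnoticed. *)
Lemma winning_assign f D C j (q : nat -> G) (d : G -> nat) :
  confined f D C -> j \notin D ->
  (forall n, step (q n) (q n.+1)) ->
  {in C &, forall u v, edge u v -> d v <= (d u).+1} ->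
  winning (assign f j (q \o d)) (j |: D) C -> winning f D C.
Proof.
move=> conf jD stepq dlip win.
have target p r : r \in C -> on_duty f D p r -> p j = q (d r) -> wins p r.
  move=> Cr dut pj; apply: win => // i /setU1P[->|Di]; rewrite /assign.
    by rewrite eqxx.
  by case: eqP => [ij|_]; [rewrite -ij Di in jD|apply: dut].
(* [k] is the position of the cop along [q], and [l] bounds the lag for every [u] in [C], so
   advancing lowers [l]. Once the robber's move makes [d r' = k], waiting puts the cop on duty. *)
have along l k p r : r \in C -> on_duty f D p r -> p j = q k -> k <= d r ->
    (forall u, u \in C -> d u <= k + l) -> wins p r.
  elim: l k p r => [|l IH] k p r Cr dut pj kd ub.
    apply: target => //; rewrite pj; congr q; apply/eqP.
    by rewrite eqn_leq kd -[X in _ <= X]addn0 ub.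
  have [Ek|lt_kd] := eqVneq k (d r); first by apply: target; rewrite // pj Ek.
  have {}lt_kd : k < d r by rewrite ltn_neqAle lt_kd.
  apply: (wins_free_move conf jD Cr dut) => r' Cr' rr'.
  have kd' : k <= d r'.
    case/orP: rr' => [/eqP<-//|rr']; rewrite -ltnS; apply: leq_trans lt_kd _.
    by apply: dlip => //; rewrite edge_sym.
  have [Ek|lt_kd'] := eqVneq k (d r').
    exists (q k); first by rewrite pj step_refl.
    by move=> p' dut' p'j; apply: target; rewrite // p'j Ek.
  exists (q k.+1); first by rewrite pj.
  move=> p' dut' p'j; apply: IH Cr' dut' p'j _ _.
    by rewrite ltn_neqAle lt_kd'.
  by move=> u Cu; rewrite addSnnS ub.
have {}along p r : r \in C -> on_duty f D p r -> p j = q 0 -> wins p r.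
  move=> Cr dut pj; apply: (along (\max_u d u) 0) => // u _.
  exact: (leq_bigmax u).
move=> p r Cr dut; have /connectP[s] := Gconn.2 (p j) (q 0).
elim: s p r Cr dut => [|y s IH] p r Cr dut /=; first by move=> _ q0; apply: along.
case/andP=> pjy ys ls; apply: (wins_free_move conf jD Cr dut) => r' Cr' rr'.
exists y; first exact: edge_step.
by move=> p' dut' p'j; apply: (IH p' r') => //; rewrite p'j.
Qed.

(** Once the cop [j] is on duty, a robber on a fixed point of [q \o d] is caught, so he is confined
    to a component of the rest of [C]. It is smaller because it misses [z], and its exits are exits
    of [C] or fixed points. *)
Lemma winning_shrink f D C j (q : nat -> G) (d : G -> nat) z :
  confined f D C -> j \notin D ->
  (forall n, step (q n) (q n.+1)) ->
  {in C &, forall u v, edge u v -> d v <= (d u).+1} ->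
  z \in C -> q (d z) = z ->
  (forall C', C' \proper C -> conn C' ->
     (forall x, attached C' x -> attached C x \/ x \in C /\ q (d x) = x) ->
     {in C', forall x, q (d x) <> x} ->
     winning (assign f j (q \o d)) (j |: D) C') ->
  winning f D C.
Proof.
move=> conf jD stepq dlip Cz dz win.
apply: (winning_assign conf jD stepq dlip) => p r Cr dut.
have [fixr|movr] := eqVneq (q (d r)) r.
  by apply: (@wins_caught _ _ _ _ j); rewrite dut ?setU11 // /assign eqxx.
pose X := [set x in C | q (d x) != x].
have Xr : r \in X by rewrite inE Cr.
have C'X := component_sub Xr; have C'r : r \in component X r by rewrite inE.
have XC : X \subset C by apply/subsetP => x; rewrite inE => /andP[].
apply: (win (component X r)) => //; last 1 first.
- by move=> x /(subsetP C'X); rewrite inE => /andP[_ /eqP].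
- apply/properP; split; first exact: subset_trans XC.
  by exists z => //; apply/negP => /(subsetP C'X); rewrite inE dz eqxx andbF.
- exact: conn_component.
move=> x /attachedP[nC'x [u C'u ux]].
have Xu := subsetP C'X u C'u; have Cu := subsetP XC u Xu.
have [Cx|nCx] := boolP (x \in C); [right|left].
  split=> //; apply/eqP; apply: contraNT nC'x => movx.
  by apply: component_edge ux; rewrite // inE Cx.
by apply/attachedP; split=> //; exists u.
Qed.

End Duties.

(* [r] is a shortest path from [u] to [v] through [C], [d] the distance from [u],
   and the duty [q \o d] is the retraction onto that path at equal distance. *)
Lemma guarded_geodesic (G : sgraph) (C : {set G}) (u v : G) :
  conn C -> attached C u -> attached C v ->
  exists (r : seq G) (q : nat -> G) (d : G -> nat),
    [/\ r != [::], {subset r <= C}, uniq r & path edge u (rcons r v)] /\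
    [/\ forall n, step (q n) (q n.+1),
        {in C &, forall x y, edge x y -> d y <= (d x).+1},
        {in C, forall x, q (d x) = x <-> x \in r},
        guards (q \o d) C u & guards (q \o d) C v].
Proof.
move=> cC /attachedP[nCu [u' Cu' u'u]] /attachedP[nCv [v' Cv' v'v]].
(* Arcs must end in [C], so distances are measured through [C] although the starting point [u] lies
   outside. *)
pose e : rel G := [rel x y | edge x y && (y \in C)].
pose reach n w := exists s : seq G, [/\ size s = n, path e u s & last u s = w].
have reach_rcons n w w' : reach n w -> w' \in C -> edge w w' -> reach n.+1 w'.
  case=> s [<- us lw] Cw' ww'; exists (rcons s w').
  by rewrite size_rcons rcons_path last_rcons us lw /e /= ww'.
have reachC w : w \in C -> exists n, reach n w.
  move=> Cw; have /connectP[s] := cC u' w Cu' Cw.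
  elim/last_ind: s w {Cw} => [|s w' IH] w /=.
    by move=> _ ->; exists 1, [:: u']; rewrite /= /e /= edge_sym u'u Cu'.
  rewrite rcons_path last_rcons => /andP[u's sw'] ->.
  have [n] := IH _ u's erefl; case/and3P: sw' => _ Cw' sw' rn.
  by exists n.+1; apply: reach_rcons sw'.
have dist w : exists n, w \in C -> reach n w /\ forall k, reach k w -> n <= k.
  have [Cw|_] := boolP (w \in C); last by exists 0.
  have reach_w : exists n, `[< reach n w >].
    by have [n rn] := reachC w Cw; exists n; apply/asboolP.
  case: (ex_minnP reach_w) => n /asboolP rn min_n; exists n => _; split=> // k rk.
  by apply: min_n; apply/asboolP.
have [d dP] := choice dist.
have d_reach w : w \in C -> reach (d w) w by move=> /dP[].
have d_min k w : w \in C -> reach k w -> d w <= k.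
  by move=> /dP[_ +] rk; apply.
have d_gt0 w : w \in C -> 0 < d w.
  move=> Cw; have [s [<- _ lw]] := d_reach w Cw; case: s lw => //= uw.
  by rewrite uw Cw in nCu.
have lip : {in C &, forall x y, edge x y -> d y <= (d x).+1}.
  by move=> x y Cx Cy xy; apply: d_min => //; apply: reach_rcons xy => //; apply: d_reach.
pose P w := (w \in C) && edge w v.
have Pv' : P v' by rewrite /P Cv'.
case: (arg_minnP d Pv') => z /andP[Cz zv] z_min.
have [r [sr ur lr]] := d_reach z Cz.
have rC : {subset r <= C}.
  elim: r (u) ur {sr lr} => //= y r IH x /andP[/andP[_ Cy] yr] w.
  by rewrite inE => /predU1P[->//|]; apply: IH yr w.
have {}ur' : path edge u (rcons r v).
  rewrite rcons_path lr zv andbT; apply: sub_path ur.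
  by move=> x y /andP[].
(* Along a shortest walk, position is distance: a shorter walk to [x], continued by [s2], would
   reach [z] too early. *)
have d_r s1 x s2 : r = s1 ++ x :: s2 -> d x = (size s1).+1.
  move=> Er; have Cx : x \in C by apply: rC; rewrite Er mem_cat inE eqxx orbT.
  move: ur lr; rewrite Er cat_path last_cat /= => /and3P[us1 s1x xs2] lz.
  apply/eqP; rewrite eqn_leq; apply/andP; split.
    by apply: d_min => //; exists (rcons s1 x); rewrite size_rcons rcons_path us1 s1x last_rcons.
  have [s [ss us ls]] := d_reach x Cx.
  have : d z <= size (s ++ s2).
    by apply: d_min => //; exists (s ++ s2); rewrite cat_path last_cat us ls xs2.
  by rewrite -sr Er !size_cat /= addnS -addSn leq_add2r ss.
have d_nth i : i < size r -> d (nth v r i) = i.+1.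
  move=> ltir; rewrite (d_r (take i r) _ (drop i.+1 r)) ?size_takel ?(ltnW ltir) //.
  by rewrite -drop_nth // cat_take_drop.
(* So [q 0 = u], the vertices of [r] have the indices from 1 to [size r], and the default [v] is the
   value at all later indices. *)
pose q := nth v (u :: r).
have stepq n : step (q n) (q n.+1).
  have [ltn|len] := ltnP n (size (rcons r v)); last first.
    have {}len : size r < n by rewrite size_rcons in len.
    by rewrite /q !nth_default ?step_refl //= ltnW.
  have nth_v s k : nth v (rcons s v) k = nth v s k.
    by rewrite nth_rcons; case: ltnP => // le; rewrite if_same nth_default.
  have /pathP-/(_ v n ltn) := ur'.
  by rewrite -rcons_cons !nth_v => /edge_step.
have q1 w : w \in C -> edge w u -> d w = 1.
  move=> Cw wu; apply/eqP; rewrite eqn_leq d_gt0 // andbT.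
  by apply: d_min => //; exists [:: w]; rewrite /= /e /= edge_sym wu Cw.
exists r, q, d; split; split=> //.
- by apply/eqP => r0; move: (d_gt0 z Cz); rewrite -sr r0.
- apply: (@map_uniq _ _ d); suff -> : map d r = iota 1 (size r) by apply: iota_uniq.
  apply: (@eq_from_nth _ 0); rewrite ?size_map ?size_iota // => i ltir.
  by rewrite (nth_map v) // nth_iota // add1n d_nth.
- move=> x Cx; split=> [|rx].
    rewrite /q; case: (ltnP (d x) (size (u :: r))) => [lt_dx|le_dx].
      move=> Ex; have := mem_nth v lt_dx; rewrite Ex inE => /predU1P[xu|//].
      by rewrite -xu Cx in nCu.
    by rewrite nth_default // => vx; rewrite vx Cx in nCv.
  by rewrite -(nth_index v rx) d_nth ?index_mem // /q /= nth_index.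
- by move=> w Cw wu; rewrite /= q1 // step_sym; apply: (stepq 0).
(* A neighbour [w] of [v] in [C] has [d w] at least [size r] by the choice of [z]; there [q] is the
   last vertex of [r], adjacent to [v], or [v] itself. *)
move=> w Cw wv; have := z_min w; rewrite /P Cw wv -sr => /(_ isT).
rewrite leq_eqVlt => /predU1P[Edw|lt_dw] /=.
  by rewrite -Edw; have := stepq (size r); rewrite {2}/q nth_default.
by rewrite /q nth_default ?step_refl.
Qed.

(** * Minor models *)

(** The branch sets of a minor [H]; they need not cover [G]. *)
Definition minor_model (G H : sgraph) (M : H -> {set G}) : Prop :=
  [/\ forall h, M h != set0,
      forall h, conn (M h),
      forall h h' x, x \in M h -> x \in M h' -> h = h' &
      forall h h', edge h h' -> exists x y, [/\ x \in M h, y \in M h' & edge x y]].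

Lemma connect_image (G G' : sgraph) (X : {set G}) (Y : {set G'}) (phi : G -> G') :
  conn X -> {in X, forall x, phi x \in Y} ->
  {in Y, forall y, exists2 x, x \in X & phi x = y} ->
  {in X &, forall x x', edge x x' -> phi x = phi x' \/ edge (phi x) (phi x')} ->
  conn Y.
Proof.
move=> cX XY YX hom _ _ /YX[x Xx <-] /YX[x' Xx' <-].
have /connectP[s] := cX x x' Xx Xx'.
elim: s x Xx => [|z s IH] x Xx /=; first by move=> _ ->; apply: connect0.
case/andP=> /and3P[_ Xz xz] zs ls; apply: connect_trans (IH z Xz zs ls).
have [->|xz'] := hom x z Xx Xz xz; first exact: connect0.
by apply: connect1; rewrite /inside /= !XY.
Qed.

(** Applied to the removal of a vertex and to the contraction of an edge. An edge between different
    branch sets cannot collapse, since their images are disjoint. *)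
Lemma minor_model_image (G G' H : sgraph) (M : H -> {set G}) (M' : H -> {set G'})
    (phi : G -> G') : minor_model M ->
  (forall h, {in M h, forall x, phi x \in M' h}) ->
  (forall h, {in M' h, forall y, exists2 x, x \in M h & phi x = y}) ->
  (forall h h', {in M h & M h', forall x x', edge x x' ->
     phi x = phi x' \/ edge (phi x) (phi x')}) ->
  (forall h h' y, y \in M' h -> y \in M' h' -> h = h') ->
  minor_model M'.
Proof.
move=> [M0 cM dM eM] MM' M'M hom dM'; split=> //.
- move=> h; have /set0Pn[x Mx] := M0 h.
  by apply/set0Pn; exists (phi x); apply: MM'.
- by move=> h; apply: (connect_image (cM h)) (MM' h) (M'M h) _; apply: hom.
move=> h h' hh'; have [x [y [Mx My xy]]] := eM h h' hh'.
exists (phi x), (phi y); split; try exact: MM'.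
case: (hom h h' x y Mx My xy) => // Exy.
have Ehh' : h = h' by apply: (dM' _ _ (phi x)); [|rewrite Exy]; apply: MM'.
by rewrite Ehh' edge_irr in hh'.
Qed.

(** The edges of [G] that [f] does not send to edges are deleted one by one. *)
Lemma spanning_has_minor (G H : sgraph) (f : G -> H) :
  bijective f -> (forall x y, edge (f x) (f y) -> edge x y) -> has_minor G H.
Proof.
move=> bij_f.
have [n] := ubnP #|[set xy : G * G | edge xy.1 xy.2 && ~~ edge (f xy.1) (f xy.2)]|.
elim: n G f bij_f => // n IH G f bij_f lt_n sub.
have [/existsP[u /existsP[v /andP[uv nfuv]]]|all_edges] :=
  boolP [exists u, exists v, edge u v && ~~ edge (f u) (f v)]; last first.
  apply: minor_iso; exists f => // x y; apply/idP/idP; first exact: sub.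
  move=> xy; apply: contraNT all_edges => nfxy.
  by apply/existsP; exists x; apply/existsP; exists y; rewrite xy.
apply: (minor_del_edge uv); apply: (IH (del_edge u v) f) => //; last first.
  move=> x y fxy; rewrite /edge /= /del_edge_rel sub //=; apply/eqP => Exy.
  have nxy : x != y by apply: contraTneq fxy => ->; rewrite edge_irr.
  have : x \in [set u; v] by rewrite -Exy !inE eqxx.
  have : y \in [set u; v] by rewrite -Exy !inE eqxx orbT.
  case/set2P=> Ey /set2P[] Ex; move: nxy nfuv fxy; rewrite Ex Ey ?eqxx //.
    by rewrite edge_sym => _ /negbTE->.
  by move=> _ /negbTE->.
rewrite -ltnS; apply: leq_trans lt_n; apply: proper_card; apply/properP; split.
  apply/subsetP => -[x y]; rewrite !inE /= /del_edge_rel.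
  by case/andP=> /andP[-> _] ->.
exists (u, v); first by rewrite inE /= uv.
by rewrite inE /= /edge /= /del_edge_rel eqxx andbF.
Qed.

(** Induction on the order of [G]: delete a vertex outside all branch sets, or contract an edge
    inside one. If neither exists, the branch sets are singletons that cover [G], so [H] is a
    spanning subgraph up to isomorphism. *)
Lemma has_minor_model (G H : sgraph) (M : H -> {set G}) :
  minor_model M -> has_minor G H.
Proof.
have [n] := ubnP #|G|; elim: n G M => // n IH G M lt_n model.
have [M0 cM dM eM] := model.
have card_lt (v : G) : #|{: {x : G | x != v}}| < n.
  rewrite card_sig -ltnS; apply: leq_trans lt_n; rewrite ltnS.
  by rewrite [X in X < _](cardC1 v) ltn_predL; apply/card_gt0P; exists v.
have [/existsP[v /forallP nMv]|cov] := boolP [exists v, forall h, v \notin M h].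
  (* The map to [del_vertex v] below needs a default value [x0]. If [v] is the only vertex, no
     branch set can be nonempty, so [H] has no vertices. *)
  have [/existsP[x0 x0v]|noM] := boolP [exists x, x != v]; last first.
    have noH (h : H) : False.
      have /set0Pn[x Mx] := M0 h; have := nMv h.
      have -> : v = x.
        apply/eqP; rewrite eq_sym; move: noM.
        by rewrite negb_exists => /forallP/(_ x)/negPn.
      by rewrite Mx.
    apply: (@minor_del_vertex _ _ v); apply: (IH (del_vertex v) (fun h => set0)); first exact: card_lt.
    by split=> h; case: (noH h).
  apply: (@minor_del_vertex _ _ v).
  pose phi : G -> del_vertex v := insubd (Sub x0 x0v).
  have phiK x : x != v -> val (phi x) = x by move=> xv; apply: insubdK.
  have Mv h x : x \in M h -> x != v by apply: contraTneq => ->.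
  apply: (IH (del_vertex v) (fun h => [set y | val y \in M h])); first exact: card_lt.
  apply: (minor_model_image (phi := phi) model).
  - by move=> h x Mx; rewrite inE phiK // (Mv h).
  - by move=> h y; rewrite inE => My; exists (val y); rewrite // /phi valKd.
  - move=> h h' x y Mx My xy; right.
    by rewrite /edge /= /del_vertex_rel (phiK _ (Mv _ _ Mx)) (phiK _ (Mv _ _ My)).
  - by move=> h h' y; rewrite !inE; apply: dM.
have {}cov x : exists h, x \in M h.
  move: cov; rewrite negb_exists => /forallP/(_ x).
  by rewrite negb_forall => /existsP[h /negPn]; exists h.
have [/existsP[u /existsP[v /andP[uv /existsP[h0 /andP[Mu Mv]]]]]|noin] :=
  boolP [exists u : G, exists v, edge u v && [exists h, (u \in M h) && (v \in M h)]].
  apply: (minor_contract uv).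
  have uv' : u != v by apply: contraTneq uv => ->; rewrite edge_irr.
  (* The default value [u] of [insubd] is the image of [v], so [phi] is the contraction map. *)
  pose phi : G -> contract u v := insubd (Sub u uv').
  have phiK x : val (phi x) = if x == v then u else x.
    by rewrite val_insubd; case: eqP.
  apply: (IH (contract u v) (fun h => [set y | val y \in M h])); first exact: card_lt.
  apply: (minor_model_image (phi := phi) model).
  - move=> h x Mx; rewrite inE phiK; case: eqP => // xv.
    by rewrite -(dM h0 h v) // -xv.
  - by move=> h y; rewrite inE => My; exists (val y); rewrite // /phi valKd.
  - move=> h h' x y Mx My xy.
    have [->|nxy] := eqVneq (phi x) (phi y); [by left|right].
    rewrite /edge /= /contract_rel nxy !phiK /=.
    case: (eqVneq x v) => [xv|_]; case: (eqVneq y v) => [yv|_].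
    + by rewrite xv yv edge_irr in xy.
    + by rewrite -xv xy eqxx orbT.
    + by rewrite -yv xy eqxx !orbT.
    + by rewrite xy.
  - by move=> h h' y; rewrite !inE; apply: dM.
have M1 h x y : x \in M h -> y \in M h -> x = y.
  move=> Mx My; have /connectP[[|z s] /=] := cM h x y Mx My; first by move=> _ ->.
  case/andP=> /and3P[_ Mz xz] _ _; move: noin.
  rewrite negb_exists => /forallP/(_ x); rewrite negb_exists => /forallP/(_ z).
  by rewrite xz => /existsP[]; exists h; rewrite Mx.
have [f fM] := choice cov.
have [g gM] := choice (fun h => set0Pn _ (M0 h)).
apply: (@spanning_has_minor _ _ f).
  exists g => [x|h]; first exact: (M1 (f x)).
  exact: (dM _ _ (g h)).
move=> x y /eM[x' [y' [Mx' My' xy']]].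
by rewrite (M1 (f x) x x') // (M1 (f y) y y').
Qed.

(** * Paths between two hubs and the minor U(H_t) *)

Lemma split_first (T : Type) (P : pred T) (s : seq T) : has P s ->
  exists s1 x s2, [/\ s = s1 ++ x :: s2, P x & ~~ has P s1].
Proof.
elim: s => //= y s IH; case: (boolP (P y)) => [Py _|nPy /= /IH].
  by exists [::], y, s.
case=> s1 [x [s2 [-> Px nPs1]]]; exists (y :: s1), x, s2.
by rewrite /= negb_or nPy.
Qed.

Lemma count_first (T : Type) (P : pred T) s1 x s2 : P x -> ~~ has P s1 ->
  count P (s1 ++ x :: s2) = (count P s2).+1.
Proof.
by move=> Px; rewrite has_count -eqn0Ngt count_cat /= Px => /eqP->.
Qed.

Section Paths.
Variable G : sgraph.
Implicit Types (A B C : {set G}) (s : seq G).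

Definition link A B := exists x y, [/\ x \in A, y \in B & edge x y].

Lemma link_sym A B : link A B -> link B A.
Proof. by case=> x [y [Ax By xy]]; exists y, x; rewrite edge_sym. Qed.

(* The inner vertices of a path from [A] to [B]; an empty [s] carries no
   information. *)
Definition joins A s B :=
  s = [::] \/ exists u v, [/\ u \in A, v \in B & path edge u (rcons s v)].

Lemma joins_rev A s B : joins A s B -> joins B (rev s) A.
Proof.
case=> [->|[u [v [Au Bv us]]]]; [by left|right; exists v, u; split=> //].
have := rev_path edge u (rcons s v); rewrite last_rcons belast_rcons rev_cons.
by move=> ->; rewrite (eq_path (e' := edge)) // => x y; apply: edge_sym.
Qed.

Lemma joins_sub A A' B B' s : A \subset A' -> B \subset B' ->
  joins A s B -> joins A' s B'.
Proof.
move=> /subsetP sA /subsetP sB [->|[u [v [Au Bv us]]]]; [by left|right].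
by exists u, v; split; [apply: sA|apply: sB|].
Qed.

Lemma joins_cat_cons A s1 x s2 B : joins A (s1 ++ x :: s2) B ->
  exists u v, [/\ u \in A, v \in B, path edge u (rcons s1 x)
                & path edge x (rcons s2 v)].
Proof.
case=> [/(congr1 size)|[u [v [Au Bv]]]]; first by rewrite size_cat addnS.
rewrite rcons_cat /= cat_path /= => /and3P[us1 s1x xs2].
by exists u, v; rewrite rcons_path us1 s1x.
Qed.

(** Cut [s] right after its first and its second vertex in [P]; the third segment still contains
    one. The edges of the path between consecutive segments and to its ends give the links. *)
Lemma three_parts (P : pred G) A s B : joins A s B -> uniq s -> 2 < count P s ->
  exists M : 'I_3 -> {set G},
    [/\ forall k, {subset M k <= s}, forall k, exists2 x, x \in M k & P x,
        forall k, conn (M k) &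
        forall k k' x, x \in M k -> x \in M k' -> k = k'] /\
    [/\ link A (M (inord 0)), link (M (inord 0)) (M (inord 1)),
        link (M (inord 1)) (M (inord 2)) & link (M (inord 2)) B].
Proof.
move=> AsB us Ps.
have [t1 [z1 [s' [Es Pz1 nPs1]]]] : exists s1 x s2, [/\ s = s1 ++ x :: s2, P x & ~~ has P s1].
  by apply: split_first; rewrite has_count; apply: leq_trans Ps.
have Ps' := Ps; rewrite Es count_first // ltnS in Ps'.
have [t2 [z2 [s3 [Es' Pz2 nPs2]]]] : exists s1 x s2, [/\ s' = s1 ++ x :: s2, P x & ~~ has P s1].
  by apply: split_first; rewrite has_count; apply: leq_trans Ps'.
have Ps3 := Ps'; rewrite Es' count_first // ltnS -has_count in Ps3.
have {nPs1 nPs2 Ps' Es' s'}Es : s = rcons t1 z1 ++ rcons t2 z2 ++ s3.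
  by rewrite Es Es' !cat_rcons.
have {Pz1}: has P (rcons t1 z1) by rewrite has_rcons Pz1.
have {Pz2}: has P (rcons t2 z2) by rewrite has_rcons Pz2.
move: (rcons t1 z1) (rcons t2 z2) s3 Ps3 Es => q1 q2 q3 P3 Es P2 P1.
case: AsB => [s0|[u [v [Au Bv p]]]]; first by rewrite s0 in Es; case: q1 Es P1.
rewrite Es in us p; case: q1 P1 Es us p => // x1 q1 P1.
case: q2 P2 => // x2 q2 P2; case: q3 P3 => // x3 q3 P3 Es us.
rewrite rcons_cat rcons_cat cat_path [path _ _ (x1 :: q1)]/= [last _ (_ :: _)]/=.
rewrite cat_path [path _ _ (x2 :: q2)]/= [last _ (x2 :: _)]/= /= rcons_path.
case/andP=> /andP[ux1 p1] /andP[/andP[l1 p2] /and3P[l2 p3 l3]].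
pose q := nth [::] [:: x1 :: q1; x2 :: q2; x3 :: q3].
have ord3 (k : 'I_3) : [\/ k = 0 :> nat, k = 1 :> nat | k = 2 :> nat].
  by case: k => [[|[|[|k]]] ltk] //; [constructor 1|constructor 2|constructor 3].
have P_q (k : 'I_3) : has P (q k) by rewrite /q; have [->|->|->] := ord3 k.
exists (fun k : 'I_3 => [set y in q k]); split; split.
- move=> k y; rewrite inE Es !mem_cat.
  by rewrite /q; have [->|->|->] := ord3 k => /= ->; rewrite ?orbT.
- by move=> k; have /hasP[y qy Py] := P_q k; exists y; rewrite ?inE.
- by move=> k; rewrite /q; have [->|->|->] := ord3 k; apply: conn_seq.
- move=> k k' y; rewrite !inE => qy qy'; apply: val_inj => /=.
  move: us qy qy'; rewrite cat_uniq cat_uniq has_cat negb_or.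
  case/and3P=> _ /andP[/hasPn d12 /hasPn d13] /and3P[_ /hasPn d23 _].
  rewrite /q; have [->|->|->] := ord3 k; have [->|->|->] := ord3 k' => //= y1 y2.
  + by have := d12 y y2; rewrite y1.
  + by have := d13 y y2; rewrite y1.
  + by have := d12 y y1; rewrite y2.
  + by have := d23 y y2; rewrite y1.
  + by have := d13 y y1; rewrite y2.
  + by have := d23 y y1; rewrite y2.
- by exists u, x1; split; rewrite // inE inordK //= inE eqxx.
- by exists (last x1 q1), x2; split; rewrite // inE inordK //= ?mem_last // inE eqxx.
- by exists (last x2 q2), x3; split; rewrite // inE inordK //= ?mem_last // inE eqxx.
- by exists (last x3 q3), v; split; rewrite // inE inordK //= ?mem_last.
Qed.

(** [C] is the branch set of the universal vertex, [A] and [B] are those of the two ends, and each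
    [s i] is cut into three branch sets with an exit each, hence adjacent to [C]. *)
Lemma theta_minor t A B C (s : 'I_t -> seq G) :
  conn A -> conn B -> conn C ->
  (exists2 x, x \in A & attached C x) -> (exists2 x, x \in B & attached C x) ->
  (forall i, joins A (s i) B) -> (forall i, uniq (s i)) ->
  (forall i, 2 < count (attached C) (s i)) ->
  {in A, forall x, x \notin B} -> {in A, forall x, x \notin C} ->
  {in B, forall x, x \notin C} ->
  (forall i, {in s i, forall x, [/\ x \notin A, x \notin B & x \notin C]}) ->
  (forall i i' x, x \in s i -> x \in s i' -> i = i') ->
  has_minor G (add_universal (theta_graph t)).
Proof.
move=> cA cB cC attA attB AsB us att3 AB AC BC sABC ss.
have [N NP] := choice (fun i => three_parts (AsB i) (us i) (att3 i)).
pose M (h : add_universal (theta_graph t)) : {set G} :=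
  match h with
  | None => C
  | Some (inl b) => if b then B else A
  | Some (inr (i, k)) => N i k
  end.
have Nsub i k x : x \in N i k -> x \in s i by have [[+ _ _ _] _] := NP i; apply.
have att h : exists2 x, x \in M (Some h) & attached C x.
  by case: h => [[]|[i k]] //; have [[_ + _ _] _] := NP i; apply.
apply: (@has_minor_model _ _ M); split.
- case=> [h|]; first by have [x Mx _] := att h; apply/set0Pn; exists x.
  by have [x _ /attachedP[_ [u Cu _]]] := attA; apply/set0Pn; exists u.
- by case=> [[[]|[i k]]|] //; have [[_ _ + _] _] := NP i; apply.
- have dAB x : x \in A -> x \in B -> False by move=> /AB /negP.
  have dAC x : x \in A -> x \in C -> False by move=> /AC /negP.
  have dBC x : x \in B -> x \in C -> False by move=> /BC /negP.
  have dsA i k x : x \in N i k -> x \in A -> False.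
    by move=> /Nsub /sABC[/negP].
  have dsB i k x : x \in N i k -> x \in B -> False.
    by move=> /Nsub /sABC[_ /negP].
  have dsC i k x : x \in N i k -> x \in C -> False.
    by move=> /Nsub /sABC[_ _ /negP].
  case=> [[[]|[i k]]|] [[[]|[i' k']]|] x //= Mx Mx';
    try by case: (dAB x). 
  + by case: (dsB i' k' x).
  + by case: (dBC x).
  + by case: (dsA i' k' x).
  + by case: (dAC x).
  + by case: (dsB i k x).
  + by case: (dsA i k x).
  + have Ei := ss _ _ _ (Nsub _ _ _ Mx) (Nsub _ _ _ Mx'); rewrite -Ei in Mx' *.
    by have [[_ _ _ dN] _] := NP i; rewrite (dN k k' x).
  + by case: (dsC i k x).
  + by case: (dBC x).
  + by case: (dAC x).
  + by case: (dsC i' k' x).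
suff main (i : 'I_t) (k l : 'I_5) : k.+1 = l ->
    link (M (Some (theta_path i k))) (M (Some (theta_path i l))).
  have linkC h : link C (M (Some h)).
    by have [x Mx /attachedP[_ [u Cu ux]]] := att h; exists u, x.
  case=> [h|] [h'|] //= hh'; [|exact/link_sym/linkC|exact: linkC].
  move: hh'; rewrite /edge /= => /existsP[i /existsP[k /existsP[l]]].
  by case/and3P=> /orP[]/eqP kl /eqP-> /eqP->; [|apply: link_sym]; apply: main.
have [_ [l1 l2 l3 l4]] := NP i.
by case: k l => [[|[|[|[|k]]]] ltk] [[|[|[|[|[|l]]]]] ltl].
Qed.

End Paths.

(** * The strategy *)

Section Strategy.
Variables (G : sgraph) (t : nat).
Hypothesis Gconn : connected G.
Implicit Types (A B C : {set G}) (D E : {set 'I_(t + 2)}) (s r : seq G).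
Implicit Types (i j : 'I_(t + 2)) (I : 'I_(t + 2) -> seq G).
Implicit Types (f : 'I_(t + 2) -> G -> G).

Lemma free_cop D : #|D| <= t.+1 -> exists j, j \notin D.
Proof.
move=> leD; have /set0Pn[j] : ~: D != set0.
  by rewrite -card_gt0 cardsCs setCK card_ord subn_gt0 (leq_ltn_trans leD) // addn2.
by rewrite inE; exists j.
Qed.

(** The new duty is the retraction onto a geodesic [r] through [C]. Since it fixes every vertex of
    [r], its 1-Lipschitz property on [C] makes it guard the new exits on [r]. *)
Lemma winning_geodesic f D C u v :
  conn C -> confined f D C -> #|D| <= t.+1 -> attached C u -> attached C v ->
  (forall C' r j g, C' \proper C -> conn C' -> j \notin D ->
     {subset r <= C} -> uniq r -> path edge u (rcons r v) ->
     {in C', forall x, x \notin r} ->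
     (forall x, attached C' x -> attached C x \/ x \in r) ->
     trackable g C' -> guards g C' u -> guards g C' v ->
     {in r, forall x, guards g C' x} ->
     winning (assign f j g) (j |: D) C') ->
  winning f D C.
Proof.
move=> cC conf leD au av win; have [j jD] := free_cop leD.
have [r [q [d [[r0 rC ur pr] [stepq lip fixr gu gv]]]]] := guarded_geodesic cC au av.
have track : trackable (q \o d) C.
  move=> x y Cx Cy xy /=; have dyx := lip x y Cx Cy xy.
  have := lip y x Cy Cx; rewrite edge_sym => /(_ xy) dxy.
  have [lt_xy|lt_yx|->] := ltngtP (d x) (d y); last exact: step_refl.
    by have -> : d y = (d x).+1 by apply/eqP; rewrite eqn_leq dyx.
  have -> : d x = (d y).+1 by apply/eqP; rewrite eqn_leq dxy.
  by rewrite step_sym.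
have [z rz] : exists z, z \in r.
  by case: (r) r0 => // z s _; exists z; rewrite inE eqxx.
apply: (winning_shrink Gconn conf jD stepq lip (rC z rz)).
  by apply/fixr => //; apply: rC.
move=> C' C'C cC' attC' movC'; have sC' := proper_sub C'C.
apply: (win C' r) => //.
- move=> x C'x; apply/negP => rx; apply: (movC' x C'x).
  by apply/fixr => //; apply: rC.
- move=> x /attC'[->|[Cx /fixr rx]]; [by left|right; exact: rx].
- exact: trackable_sub track.
- exact: guards_sub gu.
- exact: guards_sub gv.
move=> x rx w C'w wx; have Cx := rC x rx; have Cw := subsetP sC' w C'w.
by have := track w x Cw Cx wx; rewrite {2}/comp (fixr x Cx).2.
Qed.

(** The free cop settles on [z] for good, the only fixed point of a constant duty. *)
Lemma winning_vertex f D C z :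
  confined f D C -> #|D| <= t.+1 -> z \in C ->
  (forall C' j, C' \proper C -> conn C' -> j \notin D ->
     z \notin C' -> (forall x, attached C' x -> attached C x \/ x = z) ->
     winning (assign f j (fun=> z)) (j |: D) C') ->
  winning f D C.
Proof.
move=> conf leD Cz win; have [j jD] := free_cop leD.
apply: (@winning_shrink _ _ Gconn f D C j (fun=> z) (fun=> 0) z) => //.
- by move=> _; apply: step_refl.
move=> C' C'C cC' attC' movC'; apply: win => //.
- by apply/negP => /movC'.
- by move=> x /attC'[->|[_ ->]]; [left|right].
Qed.

(* Only the paths [I i] with [i \in D] matter. The cop [i] guards the path [I i],
   and the cops [ia] and [ib] also guard the hubs [A] and [B]. *)
Record state C A B ia ib D I f : Prop := State {
  st_conn : conn C;
  st_connA : conn A;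
  st_connB : conn B;
  st_card : #|D| <= t.+1;
  st_mainA : ia \in D;
  st_mainB : ib \in D;
  st_joins : forall i, i \in D -> joins A (I i) B;
  st_uniq : forall i, i \in D -> uniq (I i);
  st_AB : forall x, x \in A -> x \notin B;
  st_AC : forall x, x \in A -> x \notin C;
  st_BC : forall x, x \in B -> x \notin C;
  st_apart : forall i x, i \in D -> x \in I i -> [/\ x \notin A, x \notin B & x \notin C];
  st_disj : forall i i' x, i \in D -> i' \in D -> x \in I i -> x \in I i' -> i = i';
  st_cover : forall x, attached C x ->
    [\/ x \in A, x \in B | exists2 i, i \in D & x \in I i];
  st_A1 : forall x y, x \in A -> y \in A -> attached C x -> attached C y -> x = y;
  st_B1 : forall x y, x \in B -> y \in B -> attached C x -> attached C y -> x = y;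
  st_track : forall i, i \in D -> trackable (f i) C;
  st_guardA : forall x, x \in A -> attached C x -> guards (f ia) C x;
  st_guardB : forall x, x \in B -> attached C x -> guards (f ib) C x;
  st_guard : forall i x, i \in D -> x \in I i -> attached C x -> guards (f i) C x }.

Lemma state_confined C A B ia ib D I f : state C A B ia ib D I f -> confined f D C.
Proof.
move=> st; split=> [|x ax]; first exact: st_track st.
case: (st_cover st ax) => [Ax|Bx|[i Di Ix]]; [exists ia|exists ib|exists i] => //.
- exact: st_mainA st.
- exact: (st_guardA st Ax ax).
- exact: st_mainB st.
- exact: (st_guardB st Bx ax).
- exact: (st_guard st Di Ix ax).
Qed.

Lemma state_swap C A B ia ib D I f :
  state C A B ia ib D I f -> state C B A ib ia D (fun i => rev (I i)) f.
Proof.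
case=> ? ? ? ? ? ? sj su sAB ? ? sap sd sc ? ? ? ? ? sg; split=> //.
- by move=> i Di; apply/joins_rev/sj.
- by move=> i Di; rewrite rev_uniq su.
- by move=> x Bx; apply/negP => /sAB; rewrite Bx.
- by move=> i x Di; rewrite mem_rev => /sap[].
- by move=> i i' x Di Di'; rewrite !mem_rev; apply: sd.
- move=> x /sc[Ax|Bx|[i Di Ix]]; [by constructor 2|by constructor 1|].
  by constructor 3; exists i; rewrite ?mem_rev.
- by move=> i x Di; rewrite mem_rev; apply: sg.
Qed.

(** The induction hypothesis. It asks for one cop [i0] who guards both hubs, whereas [state] allows
    two different cops in between. *)
Definition winning_below C := forall C' A B i0 D I f,
  C' \proper C -> state C' A B i0 i0 D I f -> winning f D C'.

(** The geodesic [r] from [u] to [v] becomes part of the path [news r] of the free cop; the cops in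
    [E] keep their paths and the others are relieved. This is safe if the exits on abandoned paths
    are among [u] and [v] and lie on [news r], and the hubs keep their common guard or have no exits
    but [u] and [v]. *)
Lemma replace_paths C A B ia ib D I f E u v (news : seq G -> seq G) :
  winning_below C -> state C A B ia ib D I f ->
  attached C u -> attached C v ->
  E \subset D -> #|E| <= t ->
  ia = ib /\ ia \in E \/
    (forall x, x \in A \/ x \in B -> attached C x -> x = u \/ x = v) ->
  (forall r, {subset r <= C} -> uniq r -> path edge u (rcons r v) ->
     [/\ joins A (news r) B, uniq (news r) & {subset r <= news r}]) ->
  (forall r x, x \in news r ->
     x \in r \/ exists i, [/\ i \in D, i \notin E & x \in I i]) ->
  (forall i x, i \in D -> i \notin E -> x \in I i -> attached C x ->
     (x = u \/ x = v) /\ forall r, x \in news r) ->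
  winning f D C.
Proof.
move=> IH st au av ED leE hubs newsP news_sub old.
apply: (winning_geodesic (st_conn st) (state_confined st) (st_card st) au av).
move=> C' r j g C'C cC' jD rC ur pr C'r attC' track gu gv gr.
have sC' := proper_sub C'C; have /subsetP inC := sC'.
have jE : j \notin E by apply: contra jD => /(subsetP ED).
have [newsJ newsU rnews] := newsP r rC ur pr.
apply: (winning_subset (D' := j |: E)); first exact: setUS.
have neq i : i \in E -> (i == j) = false.
  by move=> Ei; apply: contraNF jE => /eqP<-.
pose I' i := if i == j then news r else I i.
have I'j : I' j = news r by rewrite /I' eqxx.
have I'E i : i \in E -> I' i = I i by move=> Ei; rewrite /I' neq.
have fE i : i \in E -> assign f j g i = f i by move=> Ei; rewrite /assign neq.
have fj : assign f j g j = g by rewrite /assign eqxx.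
have DE i : i \in E -> i \in D by apply/subsetP.
have attC x : x \notin C -> attached C' x -> attached C x.
  by move=> nCx /attC'[//|/rC Cx]; rewrite Cx in nCx.
have news_apart x : x \in news r -> [/\ x \notin A, x \notin B & x \notin C'].
  case/news_sub=> [rx|[i [Di _ Ix]]].
    have Cx := rC x rx; split; first by apply: contraTN Cx; apply: (st_AC st).
      by apply: contraTN Cx; apply: (st_BC st).
    by apply: contraL rx; apply: C'r.
  have [nA nB nC] := st_apart st Di Ix; split=> //.
  by apply: contra nC; apply: inC.
have news_disj i x : i \in E -> x \in I i -> x \in news r -> False.
  move=> Ei Ix /news_sub[/rC Cx|[i' [Di' nEi' Ix']]].
    by have [_ _] := st_apart st (DE i Ei) Ix; rewrite Cx.
  by rewrite -(st_disj st (DE i Ei) Di' Ix Ix') Ei in nEi'.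
(* The guard of both hubs is their common cop if kept, otherwise the new cop [j], whose duty guards
   [u] and [v]. *)
have [i0 [Di0 guardA guardB]] : exists i0, [/\ i0 \in j |: E,
    forall x, x \in A -> attached C' x -> guards (assign f j g i0) C' x &
    forall x, x \in B -> attached C' x -> guards (assign f j g i0) C' x].
  case: hubs => [[Eab Ea]|ABuv].
    exists ia; rewrite !inE Ea orbT fE //; split=> // x ABx ax.
      apply: guards_sub sC' _; apply: (st_guardA st) => //.
      by apply: attC ax; apply: (st_AC st).
    rewrite Eab; apply: guards_sub sC' _; apply: (st_guardB st) => //.
    by apply: attC ax; apply: (st_BC st).
  exists j; rewrite !inE eqxx fj; split=> // x ABx ax.
    by have [||->|->] := ABuv x; [left|apply: attC ax; apply: (st_AC st)| |].
  by have [||->|->] := ABuv x; [right|apply: attC ax; apply: (st_BC st)| |].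
apply: (IH C' A B i0 (j |: E) I') => //; split.
- exact: cC'.
- exact: st_connA st.
- exact: st_connB st.
- by rewrite cardsU1 jE.
- exact: Di0.
- exact: Di0.
- by move=> i /setU1P[->|Ei]; [rewrite I'j|rewrite I'E //; apply: (st_joins st); apply: DE].
- by move=> i /setU1P[->|Ei]; [rewrite I'j|rewrite I'E //; apply: (st_uniq st); apply: DE].
- exact: st_AB st.
- by move=> x /(st_AC st); apply: contra; apply: inC.
- by move=> x /(st_BC st); apply: contra; apply: inC.
- move=> i x /setU1P[->|Ei]; first by rewrite I'j; apply: news_apart.
  rewrite I'E // => /(st_apart st (DE i Ei))[nA nB nC].
  by split=> //; apply: contra nC; apply: inC.
- move=> i i' x /setU1P[->|Ei] /setU1P[->|Ei'] //; rewrite ?I'j ?(I'E i) ?(I'E i') //.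
  + by move=> nx Ix; case: (news_disj i' x).
  + by move=> Ix nx; case: (news_disj i x).
    exact: (st_disj st (DE i Ei) (DE i' Ei')).
- move=> x /attC'[ax|rx]; last first.
    by constructor 3; exists j; rewrite ?inE ?eqxx // I'j; apply: rnews.
  case: (st_cover st ax) => [Ax|Bx|[i Di Ix]]; [by constructor 1|by constructor 2|].
  constructor 3; have [Ei|nEi] := boolP (i \in E).
    by exists i; rewrite ?inE ?Ei ?orbT // I'E.
  by exists j; rewrite ?inE ?eqxx // I'j; apply: (old i x Di nEi Ix ax).2.
- move=> x y Ax Ay /attC-ax /attC-ay; apply: (st_A1 st) => //.
    by apply: ax; apply: (st_AC st).
  by apply: ay; apply: (st_AC st).
- move=> x y Bx By /attC-ax /attC-ay; apply: (st_B1 st) => //.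
    by apply: ax; apply: (st_BC st).
  by apply: ay; apply: (st_BC st).
- move=> i /setU1P[->|Ei]; first by rewrite fj.
  by rewrite fE //; apply: trackable_sub sC' _; apply: (st_track st); apply: DE.
- exact: guardA.
- exact: guardB.
- move=> i x /setU1P[->|Ei].
    (* An exit on the new path lies on [r], or it is an old exit equal to [u] or [v]; [g] guards all
       of these. *)
    rewrite I'j fj => nx ax; case: (news_sub r x nx) => [/gr//|[i' [Di' nEi' Ix]]].
    have [_ _ nCx] := st_apart st Di' Ix.
    by case: (old i' x Di' nEi' Ix (attC x nCx ax)) => -[->|->] _.
  rewrite I'E // fE // => Ix ax; have [_ _ nCx] := st_apart st (DE i Ei) Ix.
  by apply: guards_sub sC' _; apply: (st_guard st (DE i Ei) Ix); apply: attC.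
Qed.

(** [x] becomes the only exit of the enlarged hub, because neither [A] nor [s1] has one. Cop [i]
    guards it already and keeps the remaining path [s2]. *)
Lemma state_absorb C A B ia ib D I f i s1 x s2 :
  state C A B ia ib D I f -> (forall y, y \in A -> ~~ attached C y) ->
  i \in D -> I i = s1 ++ x :: s2 -> attached C x -> ~~ has (attached C) s1 ->
  state C (A :|: [set y in rcons s1 x]) B i ib D
    (fun k => if k == i then s2 else I k) f.
Proof.
move=> st quietA Di Ii ax /hasPn quiet1.
have [u [v [Au Bv us xs]]] : exists u v, [/\ u \in A, v \in B,
    path edge u (rcons s1 x) & path edge x (rcons s2 v)].
  by apply: joins_cat_cons; rewrite -Ii; apply: (st_joins st).
have inA' y : y \in A :|: [set y in rcons s1 x] -> y \in A \/ y \in I i /\ y \notin s2.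
  rewrite !inE => /orP[->|s1y]; [by left|right].
  have := st_uniq st Di; rewrite Ii -cat_rcons cat_uniq mem_cat s1y.
  by case/and3P=> _ /hasPn/(_ y)/contraL/(_ s1y).
have sub2 y : y \in s2 -> y \in I i by rewrite Ii mem_cat inE => ->; rewrite !orbT.
pose I' k := if k == i then s2 else I k.
have I'I k y : y \in I' k -> y \in I k by rewrite /I'; case: eqP => [->/sub2|].
have attA' y : y \in A :|: [set y in rcons s1 x] -> attached C y -> y = x.
  rewrite !inE mem_rcons inE => /or3P[/quietA/negP|/eqP|/quiet1/negP] //.
split.
- exact: st_conn st.
- by apply: conn_path us; first exact: st_connA st.
- exact: st_connB st.
- exact: st_card st.
- exact: Di.
- exact: st_mainB st.
- move=> k Dk; rewrite /I'; case: eqP => [_|_].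
    right; exists x, v; split=> //.
    by rewrite !inE mem_rcons inE eqxx orbT.
  by apply: joins_sub (st_joins st Dk); rewrite ?subsetUl.
- move=> k Dk; case: eqP => _; last exact: (st_uniq st Dk).
  by have := st_uniq st Di; rewrite Ii cat_uniq /= => /and3P[_ _ /andP[]].
- by move=> y /inA'[/(st_AB st)|[/(st_apart st Di)[]]].
- by move=> y /inA'[/(st_AC st)|[/(st_apart st Di)[]]].
- exact: st_BC st.
- move=> k y Dk I'y; have [nA nB nC] := st_apart st Dk (I'I k y I'y).
  split=> //; apply/negP => /inA'[Ay|[Iy ns2]]; first by rewrite Ay in nA.
  have Eki := st_disj st Dk Di (I'I k y I'y) Iy.
  by move: I'y ns2; rewrite /I' Eki eqxx => ->.
- move=> k k' y Dk Dk' /I'I Iy /I'I; exact: (st_disj st Dk Dk' Iy).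
- move=> y /(st_cover st)[Ay|By|[k Dk Iy]].
  + by constructor 1; rewrite inE Ay.
  + by constructor 2.
  have [Eki|nki] := eqVneq k i; last first.
    by constructor 3; exists k; rewrite // (negbTE nki).
  move: Iy; rewrite Eki Ii -cat_rcons mem_cat => /orP[s1y|s2y].
    by constructor 1; rewrite !inE s1y orbT.
  by constructor 3; exists i; rewrite ?eqxx.
- by move=> y z A'y A'z ay az; rewrite (attA' y) // (attA' z).
- exact: st_B1 st.
- exact: st_track st.
- move=> y A'y ay; rewrite (attA' y) //; apply: (st_guard st Di) => //.
  by rewrite Ii mem_cat inE eqxx orbT.
- exact: st_guardB st.
- by move=> k y Dk /I'I; apply: (st_guard st Dk).
Qed.

(** With at most one exit, one cop on a vertex [z] of [C] suffices, adjacent to the exit if there is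
    one. The set of exits and [[set z]] are the new hubs, without paths between them, and all other
    cops are relieved. *)
Lemma winning_restart C A B ia ib D I f :
  winning_below C -> state C A B ia ib D I f ->
  (forall x y, attached C x -> attached C y -> x = y) -> winning f D C.
Proof.
move=> IH st att1 p r Cr; have [z Cz zP] : exists2 z, z \in C & forall x, attached C x -> edge z x.
  have [[x ax]|noatt] := pselect (exists x, attached C x); last first.
    by exists r => // x ax; case: noatt; exists x.
  have /attachedP[_ [z Cz zx]] := ax.
  by exists z => // y ay; rewrite (att1 y x).
suff win : winning f D C by apply: win.
apply: (winning_vertex (state_confined st) (st_card st) Cz).
move=> C' j C'C cC' jD C'z attC'; have /subsetP sC' := proper_sub C'C.
apply: (winning_subset (D' := [set j])); first by rewrite sub1set setU11.
have attC x : attached C x -> x \notin C by case/andP.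
apply: (IH C' [set x | attached C x] [set z] j [set j] (fun=> [::])) => //; split.
- exact: cC'.
- by apply: conn_subsingleton => x y; rewrite !inE; apply: att1.
- exact: conn1.
- by rewrite cards1.
- by rewrite inE.
- by rewrite inE.
- by move=> i _; left.
- by [].
- by move=> x; rewrite !inE => /attC; apply: contraNneq => ->.
- by move=> x; rewrite inE => /attC; apply: contra; apply: sC'.
- by move=> x /set1P->.
- by [].
- by [].
- by move=> x /attC'[ax|->]; [constructor 1|constructor 2]; rewrite inE.
- by move=> x y; rewrite !inE => ax ay _ _; apply: att1.
- by move=> x y /set1P-> /set1P->.
- by move=> i /set1P-> u v _ _ _; rewrite /assign eqxx step_refl.
- move=> x; rewrite inE => /zP zx _ u _ _.
  by rewrite /assign eqxx edge_step.
- by move=> x /set1P-> _ u _ _; rewrite /assign eqxx step_refl.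
- by [].
Qed.

(** * Case analysis on the hubs that have exits *)

Hypothesis no_minor : minor_free (add_universal (theta_graph t)) G.

Lemma winning_hubs C A B i0 D I f a b :
  winning_below C -> state C A B i0 i0 D I f ->
  a \in A -> attached C a -> b \in B -> attached C b -> winning f D C.
Proof.
move=> IH st Aa aa Bb ab.
have joins_ab r : path edge a (rcons r b) -> joins A r B by right; exists a, b.
(* With at most [t] cops on duty, the geodesic from [a] to [b] is an additional path and nobody is
   relieved. *)
have [leDt|ltD] := leqP #|D| t.
  apply: (replace_paths (E := D) (news := id) IH st aa ab) => //.
  - by left; split=> //; apply: (st_mainA st).
  - by move=> r _ ur /joins_ab; split.
  - by left.
  - by move=> i x Di; rewrite Di.
have D0 : i0 \in D := st_mainA st.
have cardD0 : #|D :\ i0| = t.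
  have := cardsD1 i0 D; rewrite D0 => cardD; apply/eqP.
  by rewrite -(eqn_add2l 1) -cardD add1n eqn_leq (st_card st) ltD.
(* [p] and [q] are the parts of [I i] that are kept, on either side of the geodesic [r]. As [i] is
   not [i0], the guard of the hubs stays on duty while [i] is relieved. *)
have replace i p q u v : i \in D -> i != i0 -> attached C u -> attached C v ->
    subseq (p ++ q) (I i) ->
    (forall r, path edge u (rcons r v) -> joins A (p ++ r ++ q) B) ->
    (forall x, x \in I i -> attached C x -> (x = u \/ x = v) /\ x \in p ++ q) ->
    winning f D C.
  move=> Di ni0 au av sub_pq joins_new att_pq.
  have oldi k : k \in D -> k \notin D :\ i -> k = i.
    by rewrite !inE => ->; rewrite andbT => /negPn/eqP.
  apply: (replace_paths (E := D :\ i) (news := fun r => p ++ r ++ q) IH st au av).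
  - exact: subD1set.
  - by rewrite -ltnS; apply: leq_trans (st_card st); rewrite (cardsD1 i D) Di.
  - by left; rewrite !inE eq_sym ni0.
  - move=> r rC ur pr; split; first exact: joins_new.
      rewrite uniq_catCA cat_uniq ur (subseq_uniq sub_pq) ?(st_uniq st) // andbT.
      apply/hasPn => x /(mem_subseq sub_pq) Ix; apply/negP => /rC Cx.
      by have [_ _] := st_apart st Di Ix; rewrite Cx.
    by move=> x rx; rewrite !mem_cat rx orbT.
  - move=> r x; rewrite mem_cat mem_cat orbCA -mem_cat => /orP[|pqx]; [by left|right].
    by exists i; rewrite Di setD11 (mem_subseq sub_pq).
  - move=> k x Dk nEk; rewrite (oldi k) // => Ix ax.
    have [xuv pqx] := att_pq x Ix ax; split=> // r.
    by rewrite mem_cat mem_cat orbCA -mem_cat pqx orbT.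
have [/exists_inP[i Di /andP[ni0 bad]]|good] :=
  boolP [exists i in D, (i != i0) && (count (attached C) (I i) <= 2)].
  have [/split_first[s1 [x [s2 [Ii ax /[dup] q1 /hasPn quiet1]]]]|/hasPn quiet] :=
    boolP (has (attached C) (I i)); last first.
    (* No exits on [I i]: the geodesic from [a] to [b] replaces it entirely. *)
    apply: (replace i [::] [::] a b) => //; first exact: sub0seq.
      by move=> r; rewrite cats0; apply: joins_ab.
    by move=> x /quiet/negP.
  have [u0 [v0 [Au0 Bv0 us1 xs2]]] : exists u v, [/\ u \in A, v \in B,
      path edge u (rcons s1 x) & path edge x (rcons s2 v)].
    by apply: joins_cat_cons; rewrite -Ii; apply: (st_joins st).
  move: bad; rewrite Ii count_first // ltnS => bad.
  have [/split_first[s3 [y [s4 [Es2 ay /[dup] q3 /hasPn quiet3]]]]|/hasPn quiet2] :=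
    boolP (has (attached C) s2); last first.
    (* One exit [x]: the geodesic from [a] to [x] replaces the initial part [s1]. *)
    apply: (replace i [::] (x :: s2) a x) => //.
    - by rewrite Ii suffix_subseq.
    - move=> r pr; right; exists a, v0; split=> //.
      by rewrite /= rcons_cat rcons_cons -cat_rcons cat_path pr last_rcons.
    - move=> z; rewrite Ii [z \in s1 ++ _]mem_cat => /orP[/quiet1/negP//|]; rewrite inE.
      by case/predU1P=> [->|/quiet2/negP//]; rewrite eqxx; split; [right|].
  move: bad; rewrite Es2 count_first // ltnS leqn0 => quiet4.
  (* Two exits [x] and [y]: the geodesic between them replaces [s3]. *)
  apply: (replace i (rcons s1 x) (y :: s4) x y) => //.
  - by rewrite Ii Es2 cat_rcons cat_subseq //= eqxx suffix_subseq.
  - move=> r pr; right; exists u0, v0; split=> //.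
    move: xs2; rewrite Es2 rcons_cat cat_path /= => /and3P[_ _ ys4].
    rewrite !rcons_cat -cat_rcons cat_path us1 last_rcons /=.
    by rewrite cat_path pr last_rcons.
  - move=> z; rewrite Ii Es2 -cat_rcons [z \in _ ++ s3 ++ _]mem_cat [z \in s3 ++ _]mem_cat.
    rewrite [z \in y :: s4]inE.
    case/or4P=> [s1z az|/quiet3/negP//|/eqP-> _|s4z az].
    + move: s1z; rewrite mem_rcons inE => /predU1P[->|/quiet1/negP//].
      by rewrite mem_cat mem_rcons inE eqxx; split; [left|].
    + by rewrite mem_cat inE eqxx orbT; split; [right|].
    + by move: quiet4; rewrite eqn0Ngt -has_count => /hasPn/(_ z s4z)/negP.
(* Each of the [t] paths with index in [D :\ i0] now has at least three exits; [e] numbers these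
   paths. *)
case: no_minor; pose e (k : 'I_t) := enum_val (cast_ord (esym cardD0) k).
have eP k : e k \in D /\ e k != i0.
  by have := enum_valP (cast_ord (esym cardD0) k); rewrite !inE => /andP[].
apply: (@theta_minor _ t A B C (fun k => I (e k))).
- exact: st_connA st.
- exact: st_connB st.
- exact: st_conn st.
- by exists a.
- by exists b.
- by move=> k; apply: (st_joins st); have [] := eP k.
- by move=> k; apply: (st_uniq st); have [] := eP k.
- move=> k; have [Dk nk0] := eP k; rewrite ltnNge; apply: contra good => bad.
  by apply/exists_inP; exists (e k); rewrite ?nk0.
- exact: st_AB st.
- exact: st_AC st.
- exact: st_BC st.
- by move=> k x; apply: (st_apart st); have [] := eP k.
- move=> k k' x Ix Ix'; have [Dk _] := eP k; have [Dk' _] := eP k'.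
  exact/(@cast_ord_inj _ _ (esym cardD0))/enum_val_inj/(st_disj st Dk Dk' Ix Ix').
Qed.

(** The path of [i0] is tried first: if its initial part can be absorbed into [A], then [i0] still
    guards both hubs, and both have exits. *)
Lemma winning_B C A B i0 D I f b :
  winning_below C -> state C A B i0 i0 D I f ->
  (forall x, x \in A -> ~~ attached C x) -> b \in B -> attached C b ->
  winning f D C.
Proof.
move=> IH st quietA Bb ab.
have D0 : i0 \in D := st_mainA st.
have [/split_first[s1 [x [s2 [I0 ax q1]]]]|/hasPn quiet0] :=
  boolP (has (attached C) (I i0)).
  have st' := state_absorb st quietA D0 I0 ax q1.
  apply: (winning_hubs (a := x) IH st' _ ax Bb ab).
  by rewrite !inE mem_rcons inE eqxx orbT.
have [/exists_inP[i Di /split_first[s1 [x [s2 [Ii ax q1]]]]]|quiet] :=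
  boolP [exists i in D, has (attached C) (I i)]; last first.
  apply: (winning_restart IH st) => x y ax ay.
  have inB z : attached C z -> z \in B.
    move=> az; case: (st_cover st az) => [/quietA|//|[i Di Iz]]; first by rewrite az.
    case/negP: quiet; apply/exists_inP; exists i => //; apply/hasP; by exists z.
  exact: (st_B1 st (inB x ax) (inB y ay) ax ay).
have ni0 : i0 != i.
  apply: contraTneq ax => i0i; apply: quiet0; rewrite i0i Ii.
  by rewrite mem_cat inE eqxx orbT.
have st' := state_absorb st quietA Di Ii ax q1.
have A'x : x \in A :|: [set y in rcons s1 x] by rewrite !inE mem_rcons inE eqxx orbT.
(* The hubs are now guarded by different cops, [i] and [i0], and the path of [i0] has no exits. The
   geodesic between the sole exits [x] and [b] of the hubs lets the new cop guard both and relieves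
   [i0]. *)
apply: (replace_paths (E := D :\ i0) (news := id) IH st' ax ab).
- exact: subD1set.
- by rewrite -ltnS; apply: leq_trans (st_card st); rewrite (cardsD1 i0 D) D0.
- right=> y [A'y|By] ay; [left|right].
    exact: (st_A1 st' A'y A'x ay ax).
  exact: (st_B1 st' By Bb ay ab).
- by move=> r _ ur pr; split=> //; right; exists x, b.
- by left.
- move=> k y Dk; rewrite !inE Dk andbT => /negPn/eqP->.
  by rewrite (negbTE ni0) => /quiet0/negP.
Qed.

Lemma winning_state C A B i0 D I f :
  winning_below C -> state C A B i0 i0 D I f -> winning f D C.
Proof.
move=> IH st.
have quietP (X : {set G}) : (exists2 x, x \in X & attached C x) \/ forall x, x \in X -> ~~ attached C x.
  have [/exists_inP[x]|] := boolP [exists x in X, attached C x]; first by left; exists x.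
  by move=> /exists_inPn; right.
have [[b Bb ab]|quietB] := quietP B.
  have [[a Aa aa]|quietA] := quietP A; first exact: (winning_hubs IH st Aa aa Bb ab).
  exact: (winning_B IH st quietA Bb ab).
have [[a Aa aa]|quietA] := quietP A.
  exact: (winning_B IH (state_swap st) quietB Aa aa).
have [/exists_inP[i Di /split_first[s1 [x [s2 [Ii ax q1]]]]]|quiet] :=
  boolP [exists i in D, has (attached C) (I i)]; last first.
  apply: (winning_restart IH st) => x y ax; exfalso.
  case: (st_cover st ax) => [/quietA|/quietB|[i Di Ix]]; rewrite ?ax //.
  by case/negP: quiet; apply/exists_inP; exists i => //; apply/hasP; exists x.
(* As long as the hubs have no exits, any cop on duty counts as their guard. With [i] in this role,
   absorbing the start of [I i] leaves one cop for both hubs. *)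
have {}st : state C A B i i D I f.
  case: st => *; split=> // y; first by move/quietA/negP.
  by move/quietB/negP.
apply: (winning_B IH (state_swap (state_absorb st quietA Di Ii ax q1)) quietB _ ax).
by rewrite !inE mem_rcons inE eqxx orbT.
Qed.

End Strategy.

(** * The opening position and the induction on the size of the territory *)

Theorem corollary5p8 (t : nat) (ht : 1 <= t) (G : sgraph)
    (Gconn : connected G)
    (Gfree : minor_free (add_universal (theta_graph t)) G) :
  cop_number G <= t + 2.
Proof.
have all_win n : forall (C A B : {set G}) i0 D I f, #|C| < n ->
    @state G t C A B i0 i0 D I f -> winning f D C.
  elim: n => // n IH C A B i0 D I f ltC st.
  apply: (winning_state Gconn Gfree _ st) => C' A' B' i' D' I' f' C'C.
  by apply: IH; apply: leq_trans (proper_card C'C) _; rewrite -ltnS.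
have [/card_gt0P[v0 _] connG] := Gconn.
have lt0 : 0 < t + 2 by rewrite addn2.
pose i0 := Ordinal lt0.
have natt x : attached [set: G] x = false by rewrite /attached inE.
apply: (@cop_number_le G (t + 2) (fun=> v0)) => r.
(* The first territory is all of [G], which has no exits; the hubs are empty, and one cop has the
   constant duty to stay at [v0], where all cops start. *)
apply: (@all_win _ [set: G] set0 set0 i0 [set i0] (fun=> [::]) (fun _ _ => v0)
  (ltnSn _)); rewrite ?inE //.
split; rewrite ?inE ?cards1 //; try by [move=> x; rewrite inE | move=> x y; rewrite inE].
- move=> x y _ _; apply: connect_sub (connG x y) => u v uv.
  by apply: connect1; rewrite /inside /= !inE.
- by left.
- by move=> x; rewrite natt.
- by move=> i _ u v _ _ _; apply: step_refl.
Qed.
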